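(* Let $R$ be a ring, $G$ a finite group acting on $R$, $H$ a subgroup of $G$, and $n\ge 0$ an integer. Then: (1) $(n,0)\text{-ID}(RH)\le (n,0)\text{-ID}(RG)$, and equality holds when $RG$ is a separable extension over $RH$. (2) $(n,0)\text{-FD}(RH)\le (n,0)\text{-FD}(RG)$, and equality holds when $RG$ is a separable extension over $RH$. (3) $\mathrm{nC\text{-}gldim}(RH)\le \mathrm{nC\text{-}gldim}(RG)$, and equality holds when $RG$ is a separable extension over $RH$.
   Context: Rings are associative with identity; modules are unitary and are left modules unless otherwise specified. $G$ acts on $R$ by ring automorphisms: $r\mapsto g(r)$ is a ring automorphism for each $g\in G$, $(g_1g_2)(r)=g_1(g_2(r))$ and $1(r)=r$. The skew group ring $RG$ is the free left $R$-module with basis $G$ and multiplication $(ag)(bh)=a\,g(b)\,gh$ for $a,b\in R$, $g,h\in G$. For a subgroup $H\le G$ (with the restricted action), $RH$ is a subring of $RG$. A ring $A$ is a separable extension over a subring $S$ if the multiplication map $A\otimes_S A\to A$, $a\otimes b\mapsto ab$, splits as a map of $A$-$A$-bimodules; i.e. there is $\sum_i a_i\otimes b_i\in A\otimes_S A$ with $\sum_i a_i\otimes b_i a=\sum_i a a_i\otimes b_i$ for all $a\in A$ and $\sum_i a_ib_i=1$. An $A$-module $F$ is finitely $n$-presented if there is an exact sequence $F_n\to\cdots\to F_0\to F\to 0$ with all $F_i$ finitely generated projective. An $A$-module $F$ is $(n,0)$-flat if $\operatorname{Tor}_1^A(X,F)=0$ for all finitely $n$-presented right $A$-modules $X$. For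 an $A$-module $M$, each of the following is the smallest integer $k\ge0$ with the stated property ($\infty$ if no such $k$ exists): $(n,0)\text{-id}_A(M)$: $\operatorname{Ext}^{k+1}_A(F,M)=0$ for every finitely $n$-presented $A$-module $F$; $(n,0)\text{-fd}_A(M)$: $\operatorname{Tor}_{k+1}^A(F,M)=0$ for every finitely $n$-presented right $A$-module $F$; $\mathrm{nCd}_A(M)$: $\operatorname{Ext}^{k+1}_A(F,M)=0$ for every $(n,0)$-flat $A$-module $F$. The global dimensions $(n,0)\text{-ID}(A)$, $(n,0)\text{-FD}(A)$ and $\mathrm{nC\text{-}gldim}(A)$ are the suprema over all left $A$-modules $M$ of $(n,0)\text{-id}_A(M)$, $(n,0)\text{-fd}_A(M)$ and $\mathrm{nCd}_A(M)$ respectively. *)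

(* Defs.v *)
From HB Require Import structures.
From mathcomp Require Import all_boot all_fingroup all_algebra.
From mathcomp Require Import boolp functions.
From mathcomp Require Import freeg.

Set Implicit Arguments.
Unset Strict Implicit.
Unset Printing Implicit Defensive.

Import GRing.Theory.
Local Open Scope ring_scope.

(* ---------------------------------------------------------------------- *)
(* Values in nat with infinity, least elements and suprema                *)

Inductive enat := Fin of nat | Inf.

Definition enat_le (x y : enat) : bool :=
  match x, y with
  | _, Inf => true
  | Inf, Fin _ => false
  | Fin a, Fin b => a <= b
  end%N.

Definition least (P : nat -> Prop) : enat :=
  match pselect (exists k, `[< P k >]) with
  | left exP => Fin (ex_minn exP)
  | right _ => Inf
  end.

Definition esup (I : Type) (f : I -> enat) : enat :=
  least (fun k => forall i, enat_le (f i) (Fin k)).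

Lemma enat_le_leastP (P : nat -> Prop) (k : nat) :
  enat_le (least P) (Fin k) <-> exists2 j, (j <= k)%N & P j.
Proof.
rewrite /least; case: pselect => [exP|nexP] /=.
  case: ex_minnP => m /asboolP Pm minm; split=> [lemk|[j lejk Pj]].
    by exists m.
  by apply: leq_trans (minm j _) lejk; apply/asboolP.
by split=> // -[j _ Pj]; case: nexP; exists j; apply/asboolP.
Qed.

Lemma esup_leP (I : Type) (f : I -> enat) (x : enat) :
  enat_le (esup f) x <-> forall i, enat_le (f i) x.
Proof.
case: x => [k|]; last by split=> [_ i|_]; [case: (f i)|case: (esup f)].
rewrite enat_le_leastP; split=> [[j lejk fj] i|fk]; last by exists k.
by have := fj i; case: (f i) => //= a /leq_trans; apply.
Qed.

(* ---------------------------------------------------------------------- *)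
(* Left modules over A are lmodType A, right modules are lmodType A^c.    *)

Section Modules.
Variable A : pzRingType.
Implicit Types F M N P : lmodType A.

Definition fin_generated M : Prop :=
  exists (m : nat) (e : 'I_m -> M),
    forall x, exists c : 'I_m -> A, x = \sum_(i < m) c i *: e i.

Definition projective P : Prop :=
  forall (M N : lmodType A) (p : {linear M -> N}) (f : {linear P -> N}),
    (forall y, exists x, p x = y) ->
    exists h : {linear P -> M}, forall x, p (h x) = f x.

Definition exact_at (U V W : lmodType A)
    (f : {linear U -> V}) (g : {linear V -> W}) : Prop :=
  forall v, g v = 0 <-> exists u, f u = v.

Record augmented F := Augmented {
  aug_term : nat -> lmodType A;
  aug_diff : forall i, {linear aug_term i.+1 -> aug_term i};
  aug_map : {linear aug_term 0 -> F} }.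

(* Exactness of  C_n -> ... -> C_0 -> F -> 0; the terms beyond C_n are
   irrelevant. *)
Definition exact_upto (n : nat) F (C : augmented F) : Prop :=
  [/\ forall y, exists x, aug_map C x = y,
      (0 < n)%N -> exact_at (aug_diff C 0) (aug_map C)
    & forall i, (i.+1 < n)%N -> exact_at (aug_diff C i.+1) (aug_diff C i)].

Definition fin_presented (n : nat) F : Prop :=
  exists2 C : augmented F, exact_upto n C &
    forall i, (i <= n)%N -> fin_generated (aug_term C i) /\ projective (aug_term C i).

Definition proj_resolution F (C : augmented F) : Prop :=
  (forall n, exact_upto n C) /\ (forall i, projective (aug_term C i)).

Definition Hom_acyclic (k : nat) F (C : augmented F) M : Prop :=
  match k with
  | 0 => forall f : {linear aug_term C 0 -> M},
           (forall x, f (aug_diff C 0 x) = 0) -> forall x, f x = 0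
  | j.+1 => forall f : {linear aug_term C j.+1 -> M},
           (forall x, f (aug_diff C j.+1 x) = 0) ->
           exists g : {linear aug_term C j -> M}, forall x, f x = g (aug_diff C j x)
  end.

(* Ext^k_A(F, M) = 0, i.e. H^k(Hom_A(C, M)) = 0 for a projective resolution
   C of F; by the comparison theorem the choice of C is immaterial. *)
Definition Ext_zero (k : nat) F M : Prop :=
  forall C : augmented F, proj_resolution C -> Hom_acyclic k C M.

End Modules.

(* ---------------------------------------------------------------------- *)
(* Every module has a projective resolution (the standard one by free
   modules), so that Ext_zero above and Tor_zero below are not vacuous. *)

Section FreeModule.
Variables (A : pzRingType) (T : choiceType).

Definition fin_supp : {pred T -> A^o} :=
  fun u => `[< exists s : seq T, forall x, u x != 0 -> x \in s >].

Lemma fin_supp_submod : submod_closed fin_supp.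
Proof.
split=> [|a u v /asboolP[s us] /asboolP[r vr]]; apply/asboolP.
  by exists [::] => x; rewrite eqxx.
exists (s ++ r) => x auv0; rewrite mem_cat.
have [ux0|/us->//] := eqVneq (u x) 0; apply/orP; right; apply: vr.
by apply: contraNneq auv0 => vx0; rewrite /= !fctE ux0 vx0 scaler0 addr0.
Qed.

HB.instance Definition _ :=
  GRing.isSubmodClosed.Build A (T -> A^o) fin_supp fin_supp_submod.

Record free_mod := FreeMod { free_fun : T -> A^o; _ : free_fun \in fin_supp }.
HB.instance Definition _ := [isSub for free_fun].
HB.instance Definition _ := [Choice of free_mod by <:].
HB.instance Definition _ := [SubChoice_isSubLmodule of free_mod by <:].

Definition free_coef (u : free_mod) (x : T) : A := free_fun u x.

Lemma free_supp (u : free_mod) :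
  exists2 s : seq T, uniq s & forall x, free_coef u x != 0 -> x \in s.
Proof.
case: u => u /= /asboolP[s us]; exists (undup s); first exact: undup_uniq.
by move=> x /us; rewrite mem_undup.
Qed.

Lemma free_delta_proof (x : T) : (fun y => (y == x)%:R : A^o) \in fin_supp.
Proof.
apply/asboolP; exists [:: x] => y; rewrite inE.
by case: (y == x) => //; rewrite eqxx.
Qed.

Definition free_delta x : free_mod := FreeMod (free_delta_proof x).

Section Lift.
Variables (M : lmodType A) (e : T -> M).

Definition free_lift (u : free_mod) : M :=
  \sum_(x <- s2val (cid2 (free_supp u))) free_coef u x *: e x.

Lemma free_liftE (u : free_mod) (s : seq T) :
  uniq s -> (forall x, free_coef u x != 0 -> x \in s) ->
  free_lift u = \sum_(x <- s) free_coef u x *: e x.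
Proof.
rewrite /free_lift; case: cid2 => /= r r_uniq ur s_uniq us.
have red (q : seq T) : \sum_(x <- q) free_coef u x *: e x =
    \sum_(x <- [seq x <- q | free_coef u x != 0]) free_coef u x *: e x.
  rewrite big_filter [RHS]big_mkcond; apply: eq_bigr => x _.
  by case: eqP => //= ->; rewrite scale0r.
rewrite red [RHS]red; apply/perm_big/uniq_perm; rewrite ?filter_uniq // => x.
by rewrite !mem_filter; case: eqP => //= /eqP ux; rewrite ur ?us.
Qed.

Lemma free_lift_linear : linear free_lift.
Proof.
move=> a u v; have [s s_uniq us] := free_supp u.
have [r r_uniq vr] := free_supp v.
have [q q_uniq [uq vq]] : exists2 q : seq T, uniq q &
    (forall x, free_coef u x != 0 -> x \in q) /\
    (forall x, free_coef v x != 0 -> x \in q).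
  exists (undup (s ++ r)); first exact: undup_uniq.
  by split=> x h; rewrite mem_undup mem_cat; apply/orP; [left; apply: us|right; apply: vr].
rewrite (free_liftE q_uniq uq) (free_liftE q_uniq vq) (free_liftE q_uniq).
  rewrite scaler_sumr -big_split; apply: eq_bigr => x _ /=.
  by rewrite scalerA -scalerDl.
move=> x; have [ux0|/uq->//] := eqVneq (free_coef u x) 0.
have [vx0|/vq->//] := eqVneq (free_coef v x) 0.
by move: ux0 vx0; rewrite /free_coef /= !fctE => -> ->; rewrite scaler0 addr0 eqxx.
Qed.

HB.instance Definition _ :=
  GRing.isLinear.Build A free_mod M _ free_lift free_lift_linear.

Lemma free_lift_delta x : free_lift (free_delta x) = e x.
Proof.
rewrite (@free_liftE _ [:: x]) // => [|y /=]; last first.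
  by rewrite inE; case: (y == x) => //; rewrite eqxx.
by rewrite big_seq1 /= eqxx scale1r.
Qed.

End Lift.

Lemma free_deltaE (u : free_mod) : u = free_lift free_delta u.
Proof.
have [s s_uniq us] := free_supp u; rewrite (free_liftE _ s_uniq us).
apply/val_inj/funext=> y.
have sumE (q : seq T) : val (\sum_(x <- q) free_coef u x *: free_delta x) y =
    \sum_(x <- q) free_coef u x * (y == x)%:R.
  by elim: q => [|x q IH]; rewrite ?big_nil // !big_cons -IH.
rewrite sumE; have [ys|/negP yNs] := boolP (y \in s); last first.
  rewrite big_seq big1 => [|x xs].
    by apply/eqP; apply: contra_notT yNs => /us.
  by case: eqP => [yx|_]; [rewrite yx in yNs|rewrite mulr0].
rewrite (bigD1_seq y) //= eqxx mulr1 big1 ?addr0 // => x xy.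
by rewrite eq_sym (negbTE xy) mulr0.
Qed.

Lemma free_lift_ext (M : lmodType A) (f : {linear free_mod -> M}) u :
  f u = free_lift (f \o free_delta) u.
Proof.
have [s s_uniq us] := free_supp u.
rewrite {1}[u]free_deltaE !(free_liftE _ s_uniq us) linear_sum.
by apply: eq_bigr => x _; rewrite linearZ.
Qed.

Lemma free_projective : projective free_mod.
Proof.
move=> M N p f p_surj.
have /choice[e pe] : forall x, exists m, p m = f (free_delta x) by [].
exists (free_lift e) => u; have [s s_uniq us] := free_supp u.
rewrite [f u]free_lift_ext [in RHS](free_liftE _ s_uniq us).
rewrite [X in p X](free_liftE _ s_uniq us) linear_sum.
by apply: eq_bigr => x _; rewrite linearZ /= pe.
Qed.

End FreeModule.

Section Kernel.
Variables (A : pzRingType) (U V : lmodType A) (f : {linear U -> V}).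
Definition kernel_pred : {pred U} := fun u => f u == 0.
Lemma kernel_submod : submod_closed kernel_pred.
Proof.
split=> [|a u v /eqP fu /eqP fv]; apply/eqP; rewrite ?linear0 //.
by rewrite linearP fu fv scaler0 addr0.
Qed.

HB.instance Definition _ := GRing.isSubmodClosed.Build A U kernel_pred kernel_submod.
Record kernel_mod := KernelMod { kernel_val : U; _ : kernel_val \in kernel_pred }.
HB.instance Definition _ := [isSub for kernel_val].
HB.instance Definition _ := [Choice of kernel_mod by <:].
HB.instance Definition _ := [SubChoice_isSubLmodule of kernel_mod by <:].
End Kernel.

Section Resolution.
Variables (A : pzRingType) (F : lmodType A).
Definition free_cover (M : lmodType A) : {linear free_mod A M -> M} :=
  free_lift (id : M -> M).
Fixpoint syzygy (i : nat) : lmodType A :=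
  if i is j.+1 then kernel_mod (free_cover (syzygy j)) else F.
Definition std_diff i : free_mod A (syzygy i.+1) -> free_mod A (syzygy i) :=
  fun u => val (free_cover (syzygy i.+1) u).
Lemma std_diff_linear i : linear (@std_diff i).
Proof. by move=> a u v; rewrite /std_diff linearP. Qed.

HB.instance Definition _ i := GRing.isLinear.Build A _ _ _ (@std_diff i) (@std_diff_linear i).
Definition std_resolution : augmented F :=
  Augmented (aug_term := fun i => free_mod A (syzygy i)) (fun i => @std_diff i) (free_cover F).

Lemma free_cover_surj (M : lmodType A) y : exists x, free_cover M x = y.
Proof. by exists (free_delta A y); exact: (free_lift_delta (id : M -> M)). Qed.

Lemma std_exact i (v : free_mod A (syzygy i)) :
  free_cover _ v = 0 <-> exists u, std_diff u = v.
Proof.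
split=> [v0|[u <-]].
  have vk : v \in kernel_pred (free_cover (syzygy i)) by apply/eqP.
  have [u uE] := @free_cover_surj (syzygy i.+1) (KernelMod vk).
  by exists u; rewrite /std_diff uE.
by apply/eqP; exact: (valP (free_cover (syzygy i.+1) u)).
Qed.

Lemma proj_resolution_exists : exists C : augmented F, proj_resolution C.
Proof.
exists std_resolution; split=> [n|i]; last exact: free_projective.
split=> [y|_|i _] /=; first exact: free_cover_surj.
  exact: (@std_exact 0).
move=> v; rewrite -(@std_exact i.+1); split=> [/= v0|v0].
  exact: val_inj.
by rewrite /= /std_diff v0.
Qed.

End Resolution.

(* ---------------------------------------------------------------------- *)
(* The tensor product of a right and a left action of S: the free abelian
   group on X * Y modulo the subgroup generated by the usual relations.    *)

Section Tensor.
Variables (X Y : zmodType) (S : Type) (ra : X -> S -> X) (la : S -> Y -> Y).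

Definition fg_pair (x : X) (y : Y) : {freeg (X * Y)%type} :=
  Freeg [:: (1 : int, (x, y))].

Inductive tens_rel : {freeg (X * Y)%type} -> Prop :=
| TensDl x x' y : tens_rel (fg_pair (x + x') y - (fg_pair x y + fg_pair x' y))
| TensDr x y y' : tens_rel (fg_pair x (y + y') - (fg_pair x y + fg_pair x y'))
| TensM x s y : tens_rel (fg_pair (ra x s) y - fg_pair x (la s y))
| Tens0 : tens_rel 0
| TensB u v : tens_rel u -> tens_rel v -> tens_rel (u - v).

Definition tens_relb : {pred {freeg (X * Y)%type}} :=
  fun u => `[< tens_rel u >].

Lemma tens_relb_closed : zmod_closed tens_relb.
Proof.
split=> [|u v /asboolP ru /asboolP rv]; apply/asboolP; first exact: Tens0.
exact: TensB.
Qed.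

HB.instance Definition _ :=
  GRing.isZmodClosed.Build {freeg (X * Y)%type} tens_relb tens_relb_closed.

Definition tensor : zmodType := Quotient.quot tens_relb.

Definition pi_tensor (u : {freeg (X * Y)%type}) : tensor :=
  (\pi_(Quotient.quot tens_relb) u)%qT.

Definition tens (x : X) (y : Y) : tensor := pi_tensor (fg_pair x y).

Lemma pi_tensor_eq (u v : {freeg (X * Y)%type}) :
  pi_tensor u = pi_tensor v <-> tens_rel (u - v).
Proof.
have E := Quotient.idealrBE tens_relb u v.
split=> [/eqP|ruv]; first by rewrite -E => /asboolP.
by apply/eqP; rewrite -E; apply/asboolP.
Qed.

Lemma pi_tensorD : {morph pi_tensor : u v / u + v}.
Proof. exact: (raddfD \pi_(Quotient.quot tens_relb)%qT). Qed.

Lemma pi_tensorB : {morph pi_tensor : u v / u - v}.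
Proof. exact: (raddfB \pi_(Quotient.quot tens_relb)%qT). Qed.

Lemma tensDl x x' y : tens (x + x') y = tens x y + tens x' y.
Proof. by rewrite -pi_tensorD; apply/pi_tensor_eq/TensDl. Qed.

Lemma tensDr x y y' : tens x (y + y') = tens x y + tens x y'.
Proof. by rewrite -pi_tensorD; apply/pi_tensor_eq/TensDr. Qed.

Lemma tensM x s y : tens (ra x s) y = tens x (la s y).
Proof. by apply/pi_tensor_eq/TensM. Qed.

End Tensor.
Arguments tens {X Y S} ra la x y.

(* f tensor id, for f : X -> X' additive and compatible with the actions of
   S; it sends  sum x_i (x) y_i  to  sum f x_i (x) y_i. *)
Section TensorMap.
Variables (X X' Y : zmodType) (S : Type).
Variables (ra : X -> S -> X) (ra' : X' -> S -> X') (la : S -> Y -> Y).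

Definition fg_map (f : X -> X') : {freeg (X * Y)%type} -> tensor ra' la :=
  fglift (fun p : X * Y => tens ra' la (f p.1) p.2 : zmodule (tensor ra' la)).

Definition tensor_map (f : X -> X') (t : tensor ra la) : tensor ra' la :=
  fg_map f (generic_quotient.repr (t : Quotient.quot (tens_relb ra la))).

Variable f : X -> X'.
Hypothesis fD : {morph f : x y / x + y}.
Hypothesis fM : forall x s, f (ra x s) = ra' (f x) s.

Lemma fg_mapB : {morph fg_map f : u v / u - v}.
Proof. exact: (@lift_is_additive int _ (zmodule (tensor ra' la))). Qed.

Lemma fg_map0 : fg_map f 0 = 0.
Proof. by have := fg_mapB 0 0; rewrite !subrr. Qed.

Lemma fg_mapD : {morph fg_map f : u v / u + v}.
Proof.
move=> u v; have := fg_mapB u (0 - v).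
by rewrite [fg_map f (0 - v)]fg_mapB fg_map0 !sub0r !opprK.
Qed.

Lemma fg_map_pair x y : fg_map f (fg_pair x y) = tens ra' la (f x) y.
Proof. by rewrite /fg_map /fg_pair liftU scale1r. Qed.

Lemma fg_map_rel u : tens_rel ra la u -> fg_map f u = 0.
Proof.
elim=> [x x' y|x y y'|x s y||v w _ v0 _ w0].
- by rewrite fg_mapB fg_mapD !fg_map_pair fD tensDl subrr.
- by rewrite fg_mapB fg_mapD !fg_map_pair tensDr subrr.
- by rewrite fg_mapB !fg_map_pair fM tensM subrr.
- exact: fg_map0.
- by rewrite fg_mapB v0 w0 subr0.
Qed.

Lemma tensor_map_pi u : tensor_map f (pi_tensor ra la u) = fg_map f u.
Proof.
apply/eqP; rewrite -subr_eq0 -fg_mapB fg_map_rel //.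
by apply/pi_tensor_eq; apply: reprK.
Qed.

Lemma tensor_mapB : {morph tensor_map f : t u / t - u}.
Proof.
elim/quotW=> t; elim/quotW=> u; rewrite -[_ - _]pi_tensorB !tensor_map_pi.
exact: fg_mapB.
Qed.

Lemma tensor_map_tens x y :
  tensor_map f (tens ra la x y) = tens ra' la (f x) y.
Proof. by rewrite tensor_map_pi fg_map_pair. Qed.

End TensorMap.
Arguments tensor_map {X X' Y S} ra ra' la f t.

(* ---------------------------------------------------------------------- *)
Section Tor.
Variable A : pzRingType.

Definition ract (X : lmodType A^c) (x : X) (a : A) : X := (a : A^c) *: x.
Definition lact (M : lmodType A) (a : A) (m : M) : M := a *: m.

Definition tensor_diff (X : lmodType A^c) (C : augmented X) (M : lmodType A)
    (i : nat) :
    tensor (@ract (aug_term C i.+1)) (@lact M) ->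
    tensor (@ract (aug_term C i)) (@lact M) :=
  tensor_map _ _ _ (aug_diff C i).
Arguments tensor_diff {X} C M i t.

Definition tensor_acyclic (k : nat) (X : lmodType A^c) (C : augmented X)
    (M : lmodType A) : Prop :=
  match k with
  | 0 => forall t, exists u, tensor_diff C M 0 u = t
  | j.+1 => forall t, tensor_diff C M j t = 0 ->
              exists u, tensor_diff C M j.+1 u = t
  end.

(* Tor_k^A(X, M) = 0, computed from a projective resolution of the right
   module X; again the choice of the resolution is immaterial. *)
Definition Tor_zero (k : nat) (X : lmodType A^c) (M : lmodType A) : Prop :=
  forall C : augmented X, proj_resolution C -> tensor_acyclic k C M.

End Tor.

Section Dimensions.
Variables (n : nat) (A : pzRingType).

Definition n0_flat (F : lmodType A) : Prop :=
  forall X : lmodType A^c, fin_presented n X -> Tor_zero 1 X F.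

Definition n0_id (M : lmodType A) : enat :=
  least (fun k => forall F : lmodType A,
    fin_presented n F -> Ext_zero k.+1 F M).

Definition n0_fd (M : lmodType A) : enat :=
  least (fun k => forall X : lmodType A^c,
    fin_presented n X -> Tor_zero k.+1 X M).

Definition nCd (M : lmodType A) : enat :=
  least (fun k => forall F : lmodType A, n0_flat F -> Ext_zero k.+1 F M).

Definition n0_ID : enat := esup n0_id.
Definition n0_FD : enat := esup n0_fd.
Definition nC_gldim : enat := esup nCd.

End Dimensions.

(* ---------------------------------------------------------------------- *)
(* A as an extension of S through phi (in the application an inclusion):
   a separability element in A (x)_S A. *)

Definition separable_ext (S A : pzRingType) (phi : {rmorphism S -> A}) : Prop :=
  let ra (a : A) (s : S) := a * phi s in
  let la (s : S) (a : A) := phi s * a in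
  exists2 t : seq (A * A),
    forall a : A, \sum_(p <- t) tens ra la p.1 (p.2 * a) =
                  \sum_(p <- t) tens ra la (a * p.1) p.2
    & \sum_(p <- t) p.1 * p.2 = 1.

(* ---------------------------------------------------------------------- *)

Record ring_action (G : finGroupType) (R : pzRingType) := RingAction {
  ra_fun :> G -> {rmorphism R -> R};
  ra_1 : forall r, ra_fun 1%g r = r;
  ra_M : forall g h r, ra_fun (g * h)%g r = ra_fun g (ra_fun h r) }.

(* The function u stands for the sum of the (u g) g; since
   (a g) (b h) = a g(b) gh, the coefficient of k in u v is the sum of
   u(g) g(v(g^-1 k)). *)
Definition skew_group_ring (G : finGroupType) (R : pzRingType)
    (to : ring_action G R) : Type := {ffun G -> R}.

Section SkewGroupRing.
Variables (G : finGroupType) (R : pzRingType) (to : ring_action G R).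
Local Notation RG := (skew_group_ring to).

HB.instance Definition _ := GRing.Zmodule.on RG.

Definition skew_monom (a : R) (g : G) : RG :=
  [ffun k => if k == g then a else 0].

Definition skew_one : RG := skew_monom 1 1%g.

Definition skew_mul (u v : RG) : RG :=
  [ffun k => \sum_(g : G) u g * to g (v (g^-1 * k)%g)].

Lemma skew_mulA : associative skew_mul.
Proof.
move=> u v w; apply/ffunP=> k; rewrite !ffunE.
under eq_bigr => g _ do rewrite ffunE rmorph_sum mulr_sumr.
under [RHS]eq_bigr => h _ do rewrite ffunE mulr_suml.
rewrite [RHS]exchange_big /=; apply: eq_bigr => g _.
rewrite (reindex_inj (mulgI g^-1%g)) /=; apply: eq_bigr => h _.
by rewrite rmorphM -ra_M mulKVg mulrA invMg invgK -!mulgA mulKVg.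
Qed.

Lemma skew_mul1r : left_id skew_one skew_mul.
Proof.
move=> u; apply/ffunP=> k; rewrite !ffunE (bigD1 1%g) //= ffunE eqxx.
rewrite ra_1 mul1r invg1 mul1g big1 ?addr0 // => g /negbTE ng.
by rewrite ffunE ng mul0r.
Qed.

Lemma skew_mulr1 : right_id skew_one skew_mul.
Proof.
move=> u; apply/ffunP=> k; rewrite !ffunE (bigD1 k) //= ffunE mulVg eqxx.
rewrite rmorph1 mulr1 big1 ?addr0 // => g ng.
by rewrite ffunE -eq_mulVg1 (negbTE ng) rmorph0 mulr0.
Qed.

Lemma skew_mulDl : left_distributive skew_mul +%R.
Proof.
move=> u v w; apply/ffunP=> k; rewrite !ffunE -big_split /=.
by apply: eq_bigr => g _; rewrite ffunE mulrDl.
Qed.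

Lemma skew_mulDr : right_distributive skew_mul +%R.
Proof.
move=> u v w; apply/ffunP=> k; rewrite !ffunE -big_split /=.
by apply: eq_bigr => g _; rewrite ffunE rmorphD mulrDr.
Qed.

HB.instance Definition _ := GRing.Zmodule_isPzRing.Build RG
  skew_mulA skew_mul1r skew_mulr1 skew_mulDl skew_mulDr.

Lemma skew_monomM a b g h :
  skew_monom a g * skew_monom b h = skew_monom (a * to g b) (g * h)%g.
Proof.
apply/ffunP=> k; rewrite !ffunE (bigD1 g) //= !ffunE eqxx big1 => [|l nl].
  rewrite addr0 -(inj_eq (mulgI g)) mulKVg.
  by case: eqP; rewrite ?rmorph0 ?mulr0.
by rewrite ffunE (negbTE nl) mul0r.
Qed.

Lemma skew_sumE (u : RG) : u = \sum_(g : G) skew_monom (u g) g.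
Proof.
apply/ffunP=> k; rewrite sum_ffunE (bigD1 k) //= ffunE eqxx big1 ?addr0 //.
by move=> g ng; rewrite ffunE eq_sym (negbTE ng).
Qed.

End SkewGroupRing.

Section SubgroupRing.
Variables (G : finGroupType) (R : pzRingType) (to : ring_action G R).
Variable H : {group G}.

Lemma restr_act_1 r : to (sgval (1%g : [subg H])) r = r.
Proof. exact: ra_1. Qed.

Lemma restr_act_M (g h : [subg H]) r :
  to (sgval (g * h)%g) r = to (sgval g) (to (sgval h) r).
Proof. exact: ra_M. Qed.

Definition restr_action : ring_action [subg H] R :=
  RingAction (ra_fun := fun h => to (sgval h)) restr_act_1 restr_act_M.

Local Notation RG := (skew_group_ring to).
Local Notation RH := (skew_group_ring restr_action).

Definition skew_incl (u : RH) : RG :=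
  [ffun g => if g \in H then u (subg H g) else 0].

Lemma skew_incl_zmod : zmod_morphism skew_incl.
Proof.
move=> u v; apply/ffunP=> g; rewrite !ffunE.
by case: ifP => _; rewrite ?ffunE ?subrr.
Qed.

Lemma skew_incl_monoid : monoid_morphism skew_incl.
Proof.
split=> [|u v]; apply/ffunP=> k; rewrite !ffunE.
  case: ifP => [kH|/negP kH]; last by case: eqP => // k1; case: kH; rewrite k1.
  by rewrite -(inj_eq val_inj) /= subgK.
case: ifP => kH; last first.
  rewrite big1 // => g _; rewrite !ffunE; case: ifP => gH; last by rewrite mul0r.
  by rewrite groupMl ?groupV // kH rmorph0 mulr0.
rewrite (bigID (mem H)) /= [X in _ + X]big1 => [|g /negbTE ngH].
  rewrite addr0 (reindex (@sgval _ H)); last first.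
    by exists (subg H) => [h _|g gH]; [exact: sgvalK|exact: subgK].
  apply: eq_big => [h|h _]; first by rewrite subgP.
  rewrite !ffunE subgP groupMl ?groupV ?subgP // kH sgvalK.
  suff -> : subg H ((sgval h)^-1 * k)%g = (h^-1 * subg H k)%g by [].
  by apply/val_inj; rewrite /= !subgK // groupMl ?groupV ?subgP.
by rewrite ffunE ngH mul0r.
Qed.

HB.instance Definition _ :=
  GRing.isZmodMorphism.Build RH RG skew_incl skew_incl_zmod.
HB.instance Definition _ :=
  GRing.isMonoidMorphism.Build RH RG skew_incl skew_incl_monoid.

Lemma skew_incl_monom a (h : [subg H]) :
  skew_incl (skew_monom restr_action a h) = skew_monom to a (sgval h).
Proof.
apply/ffunP=> g; rewrite !ffunE; case: ifP => [gH|/negP gH].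
  by rewrite -(inj_eq val_inj) /= subgK.
by case: eqP => // gh; case: gH; rewrite gh subgP.
Qed.

End SubgroupRing.

(* Main.v *)
Require Import Defs.
From HB Require Import structures.
From mathcomp Require Import all_boot all_fingroup all_algebra.
From mathcomp Require Import boolp functions freeg.

Set Implicit Arguments.
Unset Strict Implicit.
Unset Printing Implicit Defensive.

Import GRing.Theory.
(* fingroup also defines [ract]; the tensor product of Defs must win. *)
Import Defs.
Local Open Scope ring_scope.

(** S -> A is a split Frobenius extension when it has an S-S-bimodule map
    pi : A -> S with pi 1 = 1 and dual bases x, y, i.e.
    sum_i x_i pi(y_i a) = a = sum_i pi(a x_i) y_i. For RH in RG, pi restricts
    the coefficients to H and x, y are a right transversal of H and its
    inverse. Then coinduction Hom_S(A, -) is both left and right adjoint to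
    restriction, so both functors preserve exactness, projectivity and finite
    generation, hence resolutions and finitely n-presented modules. Since N is
    a direct summand of Res Coind N (through pi), the vanishing of a given
    Ext or Tor for Coind N over A implies it for N over S. Conversely a
    separability element makes M functorially a summand of A (x)_S M, and
    vanishing for Res M over S implies vanishing for M over A. Both transfers
    happen degree by degree and on a single resolution: no comparison theorem
    is involved. *)

(** * Additive maps and finite sums *)

Lemma add_morph_sum (U V : zmodType) (f : U -> V) I (r : seq I) (F : I -> U) :
  {morph f : u v / u + v} -> f (\sum_(i <- r) F i) = \sum_(i <- r) f (F i).
Proof.
move=> fD; apply: big_morph => //.
by apply: (addIr (f 0)); rewrite -fD !add0r.
Qed.

Lemma sub_morph_sum (U V : zmodType) (f : U -> V) I (r : seq I) (F : I -> U) :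
  {morph f : u v / u - v} -> f (\sum_(i <- r) F i) = \sum_(i <- r) f (F i).
Proof.
move=> fB; have f0 : f 0 = 0 by have := fB 0 0; rewrite !subrr.
apply: add_morph_sum => u v; rewrite -{1}[v]opprK -[- v]sub0r !fB f0.
by rewrite sub0r opprK.
Qed.

(** * The tensor product as a universal balanced map *)

Section TensorLift.
Variables (X Y : zmodType) (S : Type) (ra : X -> S -> X) (la : S -> Y -> Y).

Record balanced (Z : zmodType) (f : X -> Y -> Z) : Prop := Balanced {
  balancedDl : forall x x' y, f (x + x') y = f x y + f x' y;
  balancedDr : forall x y y', f x (y + y') = f x y + f x y';
  balancedM : forall x s y, f (ra x s) y = f x (la s y) }.

(** An element of the free abelian group is an integer combination of pairs. Closure under
    subtraction also yields sums and natural multiples, and negative coefficients are reached by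
    subtracting from 0. *)
Lemma tens_ind (P : tensor ra la -> Prop) :
  P 0 -> (forall t u, P t -> P u -> P (t - u)) ->
  (forall x y, P (tens ra la x y)) -> forall t, P t.
Proof.
move=> P0 PB Pt; elim/quotW=> u; rewrite -/(pi_tensor ra la u).
have PD t v : P t -> P v -> P (t + v).
  by move=> Pt' Pv; rewrite -[v]opprK -[- v]sub0r; apply: (PB) => //; apply: PB.
have pi0 : pi_tensor ra la 0 = 0.
  by have := pi_tensorB ra la 0 0; rewrite !subrr.
have PX v n : P (pi_tensor ra la v) -> P (pi_tensor ra la (v *+ n)).
  move=> Pv; elim: n => [|n IH]; first by rewrite mulr0n pi0.
  by rewrite mulrS pi_tensorD; apply: PD.
rewrite -(freeg_sumE u); elim: (dom u) => [|[x y] s IH].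
  by rewrite big_nil pi0.
rewrite big_cons pi_tensorD; apply: PD => //.
have E c : Freeg [:: (c, (x, y))] = fg_pair x y *~ c :> {freeg (X * Y)%type}.
  by rewrite /fg_pair freegU_mulz intz.
rewrite E.
case: (coeff _ _) => n; first exact/PX/Pt.
rewrite NegzE mulrNz -sub0r pi_tensorB pi0; apply: PB => //; exact/PX/Pt.
Qed.

Section Lift.
Variables (Z : zmodType) (f : X -> Y -> Z) (fb : balanced f).

Definition fg_lift : {freeg (X * Y)%type} -> Z :=
  fglift (fun p : X * Y => f p.1 p.2 : zmodule Z).

(** Evaluates at a chosen representative. For balanced [f] the choice is harmless, since [fg_lift]
    kills every tensor relation. *)
Definition tens_lift (t : tensor ra la) : Z :=
  fg_lift (generic_quotient.repr (t : Quotient.quot (tens_relb ra la))).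

Let fg_liftB : {morph fg_lift : u v / u - v}.
Proof. exact: (@lift_is_additive int _ (zmodule Z)). Qed.

Let fg_lift0 : fg_lift 0 = 0.
Proof. by have := fg_liftB 0 0; rewrite !subrr. Qed.

Let fg_liftD : {morph fg_lift : u v / u + v}.
Proof.
move=> u v; have := fg_liftB u (0 - v).
by rewrite [fg_lift (0 - v)]fg_liftB fg_lift0 !sub0r !opprK.
Qed.

Let fg_lift_pair x y : fg_lift (fg_pair x y) = f x y.
Proof. by rewrite /fg_lift /fg_pair liftU scale1r. Qed.

Let tens_lift_pi u : tens_lift (pi_tensor ra la u) = fg_lift u.
Proof.
have rel v : tens_rel ra la v -> fg_lift v = 0.
  elim=> [x x' y|x y y'|x s y||w w' _ w0 _ w'0].
  - by rewrite fg_liftB fg_liftD !fg_lift_pair (balancedDl fb) subrr.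
  - by rewrite fg_liftB fg_liftD !fg_lift_pair (balancedDr fb) subrr.
  - by rewrite fg_liftB !fg_lift_pair (balancedM fb) subrr.
  - exact: fg_lift0.
  - by rewrite fg_liftB w0 w'0 subr0.
apply/eqP; rewrite -subr_eq0 -fg_liftB rel //.
by apply/pi_tensor_eq; apply: generic_quotient.reprK.
Qed.

Lemma tens_liftB : {morph tens_lift : t u / t - u}.
Proof.
elim/quotW=> t; elim/quotW=> u; rewrite -[_ - _]pi_tensorB !tens_lift_pi.
exact: fg_liftB.
Qed.

Lemma tens_lift0 : tens_lift 0 = 0.
Proof. by have := tens_liftB 0 0; rewrite !subrr. Qed.

Lemma tens_lift_tens x y : tens_lift (tens ra la x y) = f x y.
Proof. by rewrite tens_lift_pi fg_lift_pair. Qed.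
End Lift.

Lemma tens_ext (Z : zmodType) (h k : tensor ra la -> Z) :
  {morph h : t u / t - u} -> {morph k : t u / t - u} ->
  (forall x y, h (tens ra la x y) = k (tens ra la x y)) -> h =1 k.
Proof.
move=> hB kB hk; apply: tens_ind => // [|t u ht hu].
  by rewrite -(subrr 0) hB kB !subrr.
by rewrite hB kB ht hu.
Qed.
End TensorLift.

Lemma tensor_diff_tens (A : pzRingType) (X : lmodType A^c)
    (C : augmented X) (M : lmodType A) i c m :
  tensor_diff (C := C) (M := M) (i := i) (tens _ _ c m) = tens _ _ (aug_diff C i c) m.
Proof. by apply: tensor_map_tens => [x y|x s]; rewrite ?linearD // /ract linearZ. Qed.

Lemma tensor_diffB (A : pzRingType) (X : lmodType A^c)
    (C : augmented X) (M : lmodType A) i :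
  {morph @tensor_diff _ _ C M i : t u / t - u}.
Proof. by apply: tensor_mapB => [x y|x s]; rewrite ?linearD // /ract linearZ. Qed.

(** The families [al] and [be] induce maps of complexes of abelian groups, between tensor products
    over possibly different rings, and [be] after [al] is the identity. Homology of the first
    complex is thus a summand of that of the second. Every transfer of Tor below is an instance. *)
Lemma tensor_acyclic_retract (A B : pzRingType) (X : lmodType A^c)
    (C : augmented X) (M : lmodType A)
    (X' : lmodType B^c) (C' : augmented X') (M' : lmodType B)
    (al : forall i, aug_term C i -> M ->
       tensor (@ract _ (aug_term C' i)) (@lact _ M'))
    (be : forall i, aug_term C' i -> M' ->
       tensor (@ract _ (aug_term C i)) (@lact _ M)) :
  (forall i, balanced (@ract _ _) (@lact _ _) (al i)) ->
  (forall i, balanced (@ract _ _) (@lact _ _) (be i)) ->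
  (forall i c m, tensor_diff (al i.+1 c m) = al i (aug_diff C i c) m) ->
  (forall i c m, tensor_diff (be i.+1 c m) = be i (aug_diff C' i c) m) ->
  (forall i c m, tens_lift (be i) (al i c m) = tens _ _ c m) ->
  forall k, tensor_acyclic k.+1 C' M' -> tensor_acyclic k.+1 C M.
Proof.
move=> alb beb al_nat be_nat beal k acy t t0.
have alN i u : tensor_diff (tens_lift (al i.+1) u) = tens_lift (al i) (tensor_diff u).
  move: u; apply: (tens_ext (ra := @ract _ _) (la := @lact _ _)) => [u v|u v|c m].
  - by rewrite (tens_liftB (alb _)) tensor_diffB.
  - by rewrite tensor_diffB (tens_liftB (alb _)).
  - by rewrite tensor_diff_tens !tens_lift_tens // al_nat.
have beN i u : tensor_diff (tens_lift (be i.+1) u) = tens_lift (be i) (tensor_diff u).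
  move: u; apply: (tens_ext (ra := @ract _ _) (la := @lact _ _)) => [u v|u v|c m].
  - by rewrite (tens_liftB (beb _)) tensor_diffB.
  - by rewrite tensor_diffB (tens_liftB (beb _)).
  - by rewrite tensor_diff_tens !tens_lift_tens // be_nat.
have bealK i u : tens_lift (be i) (tens_lift (al i) u) = u.
  move: u; apply: (tens_ext (ra := @ract _ _) (la := @lact _ _)) => [u v|//|c m].
  - by rewrite (tens_liftB (alb _)) (tens_liftB (beb _)).
  - by rewrite tens_lift_tens.
have [|u uE] := acy (tens_lift (al k.+1) t); first by rewrite alN t0 (tens_lift0 (alb k)).
(* The image of the cycle [t] under [al] bounds [u]; applying [be] to [u] gives a chain bounding [t]
   itself. *)
by exists (tens_lift (be k.+2) u); rewrite beN uE bealK.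
Qed.

(** * Restriction and coinduction *)

(** A copy of the carrier with [phi] recorded in its type, so that the S-action can be declared
    without clashing with the A-action. *)
Definition restriction (S A : pzRingType) (phi : {rmorphism S -> A})
  (M : lmodType A) : Type := M.

Section Restriction.
Variables (S A : pzRingType) (phi : {rmorphism S -> A}).
Local Notation res := (restriction phi).

HB.instance Definition _ M := GRing.Zmodule.on (res M).

Section ResModule.
Variable M : lmodType A.

Definition res_scale (s : S) (x : res M) : res M := phi s *: (x : M).

Fact res_scaleA s t x : res_scale s (res_scale t x) = res_scale (s * t) x.
Proof. by rewrite /res_scale scalerA rmorphM. Qed.

Fact res_scale1 : left_id 1 res_scale.
Proof. by move=> x; rewrite /res_scale rmorph1 scale1r. Qed.

Fact res_scaleDr : right_distributive res_scale +%R.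
Proof. by move=> s x y; rewrite /res_scale scalerDr. Qed.

Fact res_scaleDl x : {morph res_scale^~ x : s t / s + t}.
Proof. by move=> s t; rewrite /res_scale rmorphD scalerDl. Qed.

HB.instance Definition _ := GRing.Zmodule_isLmodule.Build S (res M)
  res_scaleA res_scale1 res_scaleDr res_scaleDl.

Lemma res_scaleE s (x : res M) : s *: x = phi s *: (x : M).
Proof. by []. Qed.

End ResModule.

Definition res_map (M N : lmodType A) (f : M -> N) : res M -> res N := f.

Fact res_map_linear (M N : lmodType A) (f : {linear M -> N}) :
  linear (res_map f).
Proof. by move=> s x y; rewrite /res_map !res_scaleE linearP. Qed.

HB.instance Definition _ (M N : lmodType A) (f : {linear M -> N}) :=
  GRing.isLinear.Build S (res M) (res N) _ (res_map f) (res_map_linear f).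

Definition res_augmented (F : lmodType A) (C : augmented F) :
    augmented (res F : lmodType S) :=
  Augmented (aug_term := fun i => res (aug_term C i) : lmodType S)
    (fun i => res_map (aug_diff C i)) (res_map (aug_map C)).

Lemma res_exact_upto n (F : lmodType A) (C : augmented F) :
  exact_upto n C -> exact_upto n (res_augmented C).
Proof. by case. Qed.

End Restriction.

Section Coinduction.
Variables (S A : pzRingType) (phi : {rmorphism S -> A}).

Section CoindModule.
Variable N : lmodType S.

Definition coind_pred : {pred A -> N} := fun f =>
  `[< (forall a b, f (a + b) = f a + f b) /\
      forall s a, f (phi s * a) = s *: f a >].

Fact coind_pred_closed : zmod_closed coind_pred.
Proof.
split=> [|f g /asboolP[fD fZ] /asboolP[gD gZ]]; apply/asboolP.
  by split=> *; rewrite ?addr0 ?scaler0.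
split=> [a b|s a]; rewrite !fctE; first by rewrite fD gD opprD addrACA.
by rewrite fZ gZ scalerBr.
Qed.

HB.instance Definition _ :=
  GRing.isZmodClosed.Build (A -> N) coind_pred coind_pred_closed.

(** This is Hom_S(A, N), with A a left S-module through [phi]; A acts by right multiplication on the
    argument. *)
Record coind := Coind { coind_fun :> A -> N; _ : coind_fun \in coind_pred }.
HB.instance Definition _ := [isSub for coind_fun].
HB.instance Definition _ := [Choice of coind by <:].
HB.instance Definition _ := [SubChoice_isSubZmodule of coind by <:].

Lemma coind_ext (f g : coind) : f =1 g -> f = g.
Proof. by move=> fg; apply/val_inj/funext. Qed.

Lemma coindD (f : coind) a b : f (a + b) = f a + f b.
Proof. by case: f => f /= /asboolP[]. Qed.

Lemma coindM (f : coind) s a : f (phi s * a) = s *: f a.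
Proof. by case: f => f /= /asboolP[]. Qed.

Lemma coind_sum (f : coind) I (r : seq I) (F : I -> A) :
  f (\sum_(i <- r) F i) = \sum_(i <- r) f (F i).
Proof. by apply: add_morph_sum; exact: coindD. Qed.

Lemma coind_addE (f g : coind) a : (f + g) a = f a + g a.
Proof. by []. Qed.

Lemma coind_sumE I (r : seq I) (F : I -> coind) a :
  (\sum_(i <- r) F i) a = \sum_(i <- r) F i a.
Proof. by elim: r => [|i r IH]; rewrite ?big_nil // !big_cons -IH. Qed.

Fact coind_scale_subproof (a : A) (f : coind) :
  (fun b => f (b * a)) \in coind_pred.
Proof.
by apply/asboolP; split=> *; rewrite ?mulrDl ?coindD // -mulrA coindM.
Qed.

Definition coind_scale a f : coind := Coind (coind_scale_subproof a f).

Fact coind_scaleA a b f : coind_scale a (coind_scale b f) = coind_scale (a * b) f.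
Proof. by apply: coind_ext => c /=; rewrite mulrA. Qed.

Fact coind_scale1 : left_id 1 coind_scale.
Proof. by move=> f; apply: coind_ext => c /=; rewrite mulr1. Qed.

Fact coind_scaleDr : right_distributive coind_scale +%R.
Proof. by move=> a f g; apply: coind_ext. Qed.

Fact coind_scaleDl f : {morph coind_scale^~ f : a b / a + b}.
Proof.
by move=> a b; apply: coind_ext => c; rewrite coind_addE /= mulrDr coindD.
Qed.

HB.instance Definition _ := GRing.Zmodule_isLmodule.Build A coind
  coind_scaleA coind_scale1 coind_scaleDr coind_scaleDl.

Lemma coind_scaleE a (f : coind) b : (a *: f) b = f (b * a).
Proof. by []. Qed.

End CoindModule.

Section CoindMap.
Variables (M N : lmodType S) (g : {linear M -> N}).

Fact coind_map_subproof (f : coind M) : (fun a => g (f a)) \in @coind_pred N.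
Proof.
by apply/asboolP; split=> *; rewrite ?coindD ?linearD // coindM linearZ.
Qed.

Definition coind_map (f : coind M) : coind N := Coind (coind_map_subproof f).

Lemma coind_mapE f a : coind_map f a = g (f a). Proof. by []. Qed.

Fact coind_map_linear : linear coind_map.
Proof. by move=> a f f'; apply: coind_ext => b /=; rewrite linearD. Qed.

HB.instance Definition _ :=
  GRing.isLinear.Build A (coind M) (coind N) _ coind_map coind_map_linear.
End CoindMap.

Definition coind_augmented (F : lmodType S) (C : augmented F) :
    augmented (coind F : lmodType A) :=
  Augmented (aug_term := fun i => coind (aug_term C i) : lmodType A)
    (fun i => coind_map (aug_diff C i)) (coind_map (aug_map C)).

Section CoindAdjoint.
Variables (M : lmodType A) (N : lmodType S) (f : {linear restriction phi M -> N}).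

Fact coind_adj_subproof (x : M) : (fun a => f (a *: x : M)) \in @coind_pred N.
Proof.
apply/asboolP; split=> [a b|s a]; first by rewrite scalerDl linearD.
by rewrite -linearZ /= res_scaleE scalerA.
Qed.

(** The transpose of [f] for restriction as left adjoint of coinduction; [coind_ev1] transposes in
    the other direction. *)
Definition coind_adj (x : M) : coind N := Coind (coind_adj_subproof x).

Fact coind_adj_linear : linear coind_adj.
Proof.
move=> a x y; apply: coind_ext => b.
by rewrite coind_addE coind_scaleE /= scalerDr scalerA linearD.
Qed.

HB.instance Definition _ :=
  GRing.isLinear.Build A M (coind N) _ coind_adj coind_adj_linear.
End CoindAdjoint.

Definition coind_ev1 (M : lmodType A) (N : lmodType S) (h : M -> coind N) :
  restriction phi M -> N := fun x => h x 1.

Fact coind_ev1_linear (M : lmodType A) (N : lmodType S)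
  (h : {linear M -> coind N}) : linear (coind_ev1 h).
Proof.
move=> s x y; rewrite /coind_ev1 res_scaleE linearP coind_addE coind_scaleE.
(* The argument [1 * phi s] is turned into [phi s * 1], where S-linearity applies. *)
by rewrite mul1r -[phi s]mulr1 coindM.
Qed.

HB.instance Definition _ (M : lmodType A) (N : lmodType S)
    (h : {linear M -> coind N}) :=
  GRing.isLinear.Build S (restriction phi M) N _ (coind_ev1 h) (coind_ev1_linear h).

End Coinduction.
Arguments res_map {S A} phi {M N} f _.
Arguments coind_map {S A} phi {M N} g f.

(** * Split Frobenius extensions *)

Lemma fin_generated_finType (A : pzRingType) (M : lmodType A) (I : finType)
    (e : I -> M) :
  (forall x, exists c : I -> A, x = \sum_i c i *: e i) -> fin_generated M.
Proof.
move=> gen; exists #|I|, (e \o enum_val) => x; have [c xE] := gen x.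
exists (c \o enum_val); rewrite xE (reindex (@enum_val I I)) //.
by apply: onW_bij; exact: enum_val_bij.
Qed.

Record split_frobenius (S A : pzRingType) (phi : {rmorphism S -> A}) :=
  SplitFrobenius {
    fr_pi : A -> S;
    fr_index : finType;
    fr_x : fr_index -> A;
    fr_y : fr_index -> A;
    fr_piD : {morph fr_pi : a b / a + b};
    fr_piMl : forall s a, fr_pi (phi s * a) = s * fr_pi a;
    fr_piMr : forall a s, fr_pi (a * phi s) = fr_pi a * s;
    fr_pi1 : fr_pi 1 = 1;
    fr_xyE : forall a, \sum_i fr_x i * phi (fr_pi (fr_y i * a)) = a;
    fr_yxE : forall a, \sum_i phi (fr_pi (a * fr_x i)) * fr_y i = a }.
Arguments fr_x {S A phi} _ _.
Arguments fr_y {S A phi} _ _.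

(* The sum of the [p i (x) q i] in A (x)_S A commutes with A, as tested against
   all balanced maps. *)
Definition casimir (S A : pzRingType) (phi : {rmorphism S -> A})
  (I : Type) (r : seq I) (p q : I -> A) : Prop :=
  forall (Z : zmodType) (b : A -> A -> Z),
    balanced (fun a s => a * phi s) (fun s a => phi s * a) b ->
    forall a, \sum_(i <- r) b (p i) (q i * a) = \sum_(i <- r) b (a * p i) (q i).

(** Expand y_i a as sum_j phi(pi(y_i a x_j)) y_j, move the scalars across the balanced map, and
    collect sum_i x_i phi(pi(y_i a x_j)) = a x_j. *)
Lemma casimir_frobenius (S A : pzRingType) (phi : {rmorphism S -> A})
    (fr : split_frobenius phi) :
  casimir phi (index_enum (fr_index fr)) (fr_x fr) (fr_y fr).
Proof.
move=> Z b bB a.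
have b_suml (F : fr_index fr -> A) v : b (\sum_i F i) v = \sum_i b (F i) v.
  exact: (add_morph_sum _ F (fun u u' => balancedDl bB u u' v)).
have b_sumr (F : fr_index fr -> A) u : b u (\sum_i F i) = \sum_i b u (F i).
  exact: (add_morph_sum _ F (balancedDr bB u)).
under eq_bigr => i _.
  rewrite -[fr_y fr i * a](fr_yxE fr) b_sumr.
  under eq_bigr => j _ do rewrite -(balancedM bB).
  over.
rewrite exchange_big; apply: eq_bigr => j _ /=.
by rewrite -b_suml -[a * _](fr_xyE fr); under eq_bigr do rewrite -mulrA.
Qed.

Section Opposite.
Variables (S A : pzRingType) (phi : {rmorphism S -> A}).

Definition op_morphism : S^c -> A^c := phi.

Fact op_morphism_zmod : zmod_morphism op_morphism.
Proof. exact: (rmorphB phi). Qed.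

Fact op_morphism_monoid : monoid_morphism op_morphism.
Proof. by split=> [|s t]; [exact: (rmorph1 phi)|exact: (rmorphM phi)]. Qed.

HB.instance Definition _ :=
  GRing.isZmodMorphism.Build S^c A^c op_morphism op_morphism_zmod.
HB.instance Definition _ :=
  GRing.isMonoidMorphism.Build S^c A^c op_morphism op_morphism_monoid.

(** The notion is left-right symmetric: over the opposite rings the two dual bases trade places.
    Results on left modules thereby apply to right modules. *)
Definition op_frobenius (fr : split_frobenius phi) :
    split_frobenius op_morphism :=
  @SplitFrobenius S^c A^c op_morphism (fr_pi fr) _ (fr_y fr) (fr_x fr)
    (fr_piD fr) (fun s a => fr_piMr fr a s) (fun a s => fr_piMl fr s a)
    (fr_pi1 fr) (fr_yxE fr) (fr_xyE fr).

End Opposite.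

(** * Restriction and coinduction along a split Frobenius extension *)

Section Frobenius.
Variables (S A : pzRingType) (phi : {rmorphism S -> A}).
Variable fr : split_frobenius phi.
Local Notation coind := (coind phi).
Local Notation res := (restriction phi).
Local Notation pi := (fr_pi fr).
Local Notation x_ := (fr_x fr).
Local Notation y_ := (fr_y fr).

(** The [y_ i] generate A as a left S-module, so their products with generators of M over A generate
    M over S. *)
Lemma res_fin_generated (M : lmodType A) :
  fin_generated M -> fin_generated (res M : lmodType S).
Proof.
case=> m [e gen].
apply: (@fin_generated_finType S (res M) ('I_m * fr_index fr)%type
  (fun ki => y_ ki.2 *: e ki.1 : M)) => x.
have [c ->] := gen x; exists (fun ki => pi (c ki.1 * x_ ki.2)).
rewrite -(pair_bigA _ (fun k i => pi (c k * x_ i) *: (y_ i *: e k : res M))) /=.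
apply: eq_bigr => k _; rewrite -{1}[c k](fr_yxE fr) scaler_suml.
by apply: eq_bigr => i _; rewrite res_scaleE scalerA.
Qed.

Section Unit.
Variable N : lmodType S.

Fact coind_unit_subproof (v : N) :
  (fun a => pi a *: v) \in @coind_pred S A phi N.
Proof.
by apply/asboolP; split=> *; rewrite ?fr_piD ?scalerDl // fr_piMl scalerA.
Qed.

(** The unit of the adjunction in which coinduction is the left adjoint. Evaluation at 1 splits it,
    because pi 1 = 1. *)
Definition coind_unit (v : N) : res (coind N) := Coind (coind_unit_subproof v).

Lemma coind_unitE v a : (coind_unit v : coind N) a = pi a *: v.
Proof. by []. Qed.

Fact coind_unit_linear : linear coind_unit.
Proof.
move=> s u v; rewrite res_scaleE; apply: (@coind_ext S A phi) => a.
by rewrite coind_addE coind_scaleE !coind_unitE fr_piMr scalerDr scalerA.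
Qed.

HB.instance Definition _ :=
  GRing.isLinear.Build S N (res (coind N)) _ coind_unit coind_unit_linear.

Lemma coind_unitZ s v : coind_unit (s *: v) = phi s *: (coind_unit v : coind N).
Proof. exact: linearZ. Qed.

(** Apply f to a = sum_i phi(pi(a x_i)) y_i. Hence Coind N is generated over A by the image of the
    unit, and f plays the role of sum_i x_i (x) f(y_i) in A (x)_S N. *)
Lemma coind_expand (f : coind N) :
  f = \sum_i x_ i *: (coind_unit (f (y_ i)) : coind N).
Proof.
apply: coind_ext => a; rewrite coind_sumE.
under eq_bigr do rewrite coind_scaleE coind_unitE -coindM.
by rewrite -coind_sum fr_yxE.
Qed.

End Unit.

Lemma coind_map_unit (M N : lmodType S) (g : {linear M -> N}) v :
  coind_map phi g (coind_unit v) = coind_unit (g v).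
Proof. by apply: coind_ext => a; rewrite coind_mapE !coind_unitE linearZ. Qed.

(** By [coind_expand] it suffices to choose preimages of the finitely many values f(y_i) and
    reassemble them with the x_i. This gives right exactness of coinduction. *)
Lemma coind_map_lift (M N : lmodType S) (g : {linear M -> N}) (f : coind N) :
  (forall a, exists u, g u = f a) -> exists f', coind_map phi g f' = f.
Proof.
move=> gf; have /choice[u uE] i : exists u, g u = f (y_ i) by [].
exists (\sum_i x_ i *: (coind_unit (u i) : coind M)).
rewrite linear_sum [f in RHS]coind_expand; apply: eq_bigr => i _.
by rewrite linearZ /= coind_map_unit uE.
Qed.

Lemma coind_exact (U V W : lmodType S) (f : {linear U -> V}) (g : {linear V -> W}) :
  exact_at f g -> exact_at (coind_map phi f) (coind_map phi g).
Proof.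
move=> ex v; split=> [gv0|[u <-]]; last first.
  by apply: coind_ext => a; apply/ex; exists (u a).
by apply: coind_map_lift => a; apply/ex; rewrite -[LHS]/(coind_map phi g v a) gv0.
Qed.

Lemma coind_exact_upto n (F : lmodType S) (C : augmented F) :
  exact_upto n C -> exact_upto n (coind_augmented phi C).
Proof.
case=> surj ex0 ex; split=> [f|n0|i ltin]; first exact: coind_map_lift.
  exact/coind_exact/ex0.
exact/coind_exact/ex.
Qed.

Lemma coind_fin_generated (M : lmodType S) :
  fin_generated M -> fin_generated (coind M : lmodType A).
Proof.
case=> m [e gen].
apply: (@fin_generated_finType A (coind M) 'I_m (fun k => coind_unit (e k))).
move=> f; have /choice[c cE] i := gen (f (y_ i)).
(* Write f(y_i) = sum_k c_ik e_k in [coind_expand]; the unit turns the scalar c_ik into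
   phi(c_ik). *)
exists (fun k => \sum_i x_ i * phi (c i k)).
rewrite [LHS]coind_expand.
under eq_bigr do rewrite cE linear_sum scaler_sumr.
rewrite exchange_big; apply: eq_bigr => k _; rewrite scaler_suml.
by apply: eq_bigr => i _; rewrite /= coind_unitZ scalerA.
Qed.

Section LeftAdjoint.
Variables (M : lmodType A) (N : lmodType S) (g : {linear N -> res M}).

(** The transpose of [g] for coinduction as left adjoint of restriction: on A (x)_S N it is a (x) v
    |-> a g(v). *)
Definition coind_ladj (f : coind N) : M := \sum_i x_ i *: (g (f (y_ i)) : M).

Fact coind_ladj_linear : linear coind_ladj.
Proof.
move=> a f f'; rewrite /coind_ladj scaler_sumr.
under eq_bigr do rewrite coind_addE coind_scaleE linearD scalerDr.
rewrite big_split; congr (_ + _) => /=.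
(* The Casimir identity moves [a] from the argument y_i a to the front of x_i. *)
rewrite (casimir_frobenius fr (b := fun u v => u *: (g (f v) : M))).
  by apply: eq_bigr => i _; rewrite scalerA.
split=> [u u' v|u v v'|u s v]; first exact: scalerDl.
  by rewrite coindD linearD scalerDr.
by rewrite coindM linearZ /= res_scaleE scalerA.
Qed.

HB.instance Definition _ :=
  GRing.isLinear.Build A (coind N) M _ coind_ladj coind_ladj_linear.
End LeftAdjoint.

(** A left adjoint of a functor preserving surjections preserves projectives: lift the transpose
    over S and transpose back. Equality is checked on the generators from [coind_expand]. *)
Lemma coind_projective (P : lmodType S) :
  projective P -> projective (coind P : lmodType A).
Proof.
move=> projP M N p f p_surj.
have [h hE] := projP (res M) (res N) (res_map phi p)
  (res_map phi f \o @coind_unit P) p_surj.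
exists (coind_ladj h) => u; rewrite [u in RHS]coind_expand !linear_sum.
by apply: eq_bigr => i _; rewrite !linearZ; congr (_ *: _); exact: hE.
Qed.

(** The same argument for the other adjunction, coinduction preserving surjections by
    [coind_map_lift]. *)
Lemma res_projective (P : lmodType A) :
  projective P -> projective (res P : lmodType S).
Proof.
move=> projP M N p f p_surj.
have [|h hE] := projP (coind M) (coind N) (coind_map phi p) (coind_adj f).
  by move=> u; apply: coind_map_lift.
exists (coind_ev1 h) => c; rewrite -[LHS]/(coind_map phi p (h c) 1) hE.
by rewrite /= scale1r.
Qed.

Lemma coind_proj_resolution (F : lmodType S) (C : augmented F) :
  proj_resolution C -> proj_resolution (coind_augmented phi C).
Proof.
by case=> ex proj; split=> i; [exact: coind_exact_upto|exact: coind_projective].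
Qed.

Lemma res_proj_resolution (F : lmodType A) (C : augmented F) :
  proj_resolution C -> proj_resolution (res_augmented phi C).
Proof.
by case=> ex proj; split=> i; [exact: res_exact_upto|exact: res_projective].
Qed.

Lemma coind_fin_presented n (F : lmodType S) :
  fin_presented n F -> fin_presented n (coind F : lmodType A).
Proof.
case=> C ex fgp; exists (coind_augmented phi C); first exact: coind_exact_upto.
by move=> i /fgp[]; split; [exact: coind_fin_generated|exact: coind_projective].
Qed.

Lemma res_fin_presented n (F : lmodType A) :
  fin_presented n F -> fin_presented n (res F : lmodType S).
Proof.
case=> C ex fgp; exists (res_augmented phi C); first exact: res_exact_upto.
by move=> i /fgp[]; split; [exact: res_fin_generated|exact: res_projective].
Qed.

Lemma coind_Ext_zero k (F N : lmodType S) :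
  Ext_zero k.+1 (coind F : lmodType A) (coind N) -> Ext_zero k.+1 F N.
Proof.
move=> ext C resC f f0.
have [|g gE] := ext _ (coind_proj_resolution resC) (coind_map phi f).
  by move=> u; apply: coind_ext => a; exact: f0.
(* The A-linear factor [g] is cut down to S by precomposing with the unit and evaluating at 1; on
   the coinduced cocycle this operation returns f, as pi 1 = 1. *)
exists (coind_ev1 g \o @coind_unit _) => x.
have E : coind_map phi f (coind_unit x) =
  g (coind_map phi (aug_diff C k) (coind_unit x)) by exact: gE.
move/(congr1 (fun u : coind N => u 1)): E.
by rewrite !coind_map_unit /= fr_pi1 scale1r.
Qed.

End Frobenius.

(** * Comparison of tensor products and Tor *)

Lemma tens_sumr (X Y : zmodType) (S : Type) (ra : X -> S -> X)
    (la : S -> Y -> Y) I (r : seq I) x (F : I -> Y) :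
  tens ra la x (\sum_(i <- r) F i) = \sum_(i <- r) tens ra la x (F i).
Proof.
exact: (add_morph_sum r F (tensDr ra la x)).
Qed.

Section Casimir.
Variables (S A : pzRingType) (phi : {rmorphism S -> A}).

(** The uncurried form of an A-linear map from Y to Hom_S(A, Y'). It covers both scalar
    multiplication into Res M and evaluation on Coind N. *)
Record equivariant (Y : lmodType A) (Y' : lmodType S) (k : A -> Y -> Y') : Prop :=
  Equivariant {
    equivD1 : forall y, {morph k^~ y : a b / a + b};
    equivD2 : forall a, {morph k a : y z / y + z};
    equivA : forall a b y, k a (b *: y) = k (a * b) y;
    equivS : forall s a y, k (phi s * a) y = s *: k a y }.

Lemma equivariant_scale (M : lmodType A) :
  equivariant (fun a (x : M) => (a *: x : M) : restriction phi M).
Proof.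
split=> [y a b|a y z|a b y|s a y].
- exact: (scalerDl (y : M)).
- exact: (scalerDr a (y : M)).
- exact: (scalerA a b (y : M)).
- by rewrite res_scaleE scalerA.
Qed.

Lemma equivariant_eval (N : lmodType S) :
  equivariant (fun a (f : coind phi N) => f a).
Proof. by split=> [f a b|//|//|s a f]; [exact: coindD|exact: coindM]. Qed.
End Casimir.

Section CasimirTensor.
Variables (S A : pzRingType) (phi : {rmorphism S -> A}).
Variables (I : Type) (r : seq I) (p q : I -> A).

(** Inserts a Casimir element between x and y, which sends a tensor over A to a tensor over S. *)
Definition casimir_tens (X : Type) (X' : lmodType S^c) (Y : Type) (Y' : lmodType S)
    (h : A -> X -> X') (k : A -> Y -> Y') (x : X) (y : Y) :=
  \sum_(i <- r) tens (@ract S X') (@lact S Y') (h (p i) x) (k (q i) y).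

Lemma casimir_tens_balanced (X : lmodType A^c) (X' : lmodType S^c)
    (Y : lmodType A) (Y' : lmodType S) (h : A -> X -> X') (k : A -> Y -> Y') :
  casimir phi r p q ->
  @equivariant S^c A^c (op_morphism phi) X X' h -> equivariant phi k ->
  balanced (@ract A X) (@lact A Y) (casimir_tens h k).
Proof.
move=> cas hP kP; split=> [x x' y|x y y'|x a y]; rewrite /casimir_tens.
- by rewrite -big_split; apply: eq_bigr => i _; rewrite (equivD2 hP) tensDl.
- by rewrite -big_split; apply: eq_bigr => i _; rewrite (equivD2 kP) tensDr.
rewrite /ract /lact.
(* Products in [A^c] are reversed, so [h (p i)] at x a is [h (a * p i)] at x; what remains is the
   Casimir identity for u, v |-> h u x (x) k v y. *)
under eq_bigr => i _ do rewrite (equivA hP).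
under [RHS]eq_bigr => i _ do rewrite (equivA kP).
rewrite -(cas _ (fun u v => tens (@ract S X') (@lact S Y') (h u x) (k v y))) //.
split=> [u u' v|u v v'|u s v].
- by rewrite (equivD1 hP) tensDl.
- by rewrite (equivD1 kP) tensDr.
- by rewrite (equivS kP) -[_ *: _]/(lact _ _) -tensM /ract -(equivS hP).
Qed.
End CasimirTensor.

(** A balanced map factors through the tensor product; apply the factorization to the separability
    identity. *)
Lemma casimir_separable (S A : pzRingType) (phi : {rmorphism S -> A})
    (t : seq (A * A)) :
  (forall a : A,
    \sum_(p <- t) tens (fun a s => a * phi s) (fun s a => phi s * a) p.1 (p.2 * a) =
    \sum_(p <- t) tens (fun a s => a * phi s) (fun s a => phi s * a) (a * p.1) p.2) ->
  casimir phi t fst snd.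
Proof.
move=> tE Z b bB a; have := congr1 (tens_lift b) (tE a).
rewrite !(sub_morph_sum _ _ (tens_liftB bB)).
under eq_bigr do rewrite (tens_lift_tens bB).
by under [X in _ = X -> _]eq_bigr do rewrite (tens_lift_tens bB).
Qed.

Section TensorComparison.
Variables (S A : pzRingType) (phi : {rmorphism S -> A}).
Local Notation res := (restriction phi).
Local Notation rres := (@restriction S^c A^c (op_morphism phi)).

Lemma balanced_tens_res (X : lmodType S^c) (X' : lmodType A^c)
    (Y : lmodType S) (Y' : lmodType A)
    (e : {linear X -> rres X'}) (e' : {linear Y -> res Y'}) :
  balanced (@ract S X) (@lact S Y)
    (fun x y => tens (@ract A X') (@lact A Y') (e x) (e' y)).
Proof.
split=> [x x' y|x y y'|x s y]; first by rewrite linearD tensDl.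
  by rewrite linearD tensDr.
by rewrite /ract /lact !linearZ; exact: tensM.
Qed.

Lemma tens_casimir_sum (I : Type) (r : seq I) (p q : I -> A)
    (X : lmodType A^c) (Y : lmodType A) (x : X) (y : Y) :
  \sum_(i <- r) p i * q i = 1 ->
  \sum_(i <- r) tens (@ract A X) (@lact A Y) (ract x (p i)) (q i *: y) =
  tens (@ract A X) (@lact A Y) x y.
Proof.
move=> pq1; rewrite -[y in RHS]scale1r -pq1 scaler_suml tens_sumr.
by apply: eq_bigr => i _; rewrite tensM /lact scalerA.
Qed.

End TensorComparison.

Section FrobeniusTor.
Variables (S A : pzRingType) (phi : {rmorphism S -> A}).
Variable fr : split_frobenius phi.
Local Notation rcoind := (@coind S^c A^c (op_morphism phi)).
Local Notation coind := (coind phi).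
Local Notation res := (restriction phi).
Local Notation rres := (@restriction S^c A^c (op_morphism phi)).
Local Notation rfr := (op_frobenius fr).
Local Notation frE := (index_enum (fr_index fr)).
Local Notation x_ := (fr_x fr).
Local Notation y_ := (fr_y fr).

Lemma tensor_diff_casimir_tens (I : Type) (r : seq I) (p q : I -> A)
    (X : Type) (Y : Type) (Y' : lmodType S) (F : lmodType S^c) (C : augmented F) j
    (h : A -> X -> aug_term C j.+1) (k : A -> Y -> Y') x y :
  tensor_diff (casimir_tens r p q h k x y) =
  casimir_tens r p q (fun a x => aug_diff C j (h a x)) k x y.
Proof.
rewrite (sub_morph_sum _ _ (@tensor_diffB _ _ C _ j)).
by apply: eq_bigr => i _; rewrite tensor_diff_tens.
Qed.

(** Tor^A(X, Coind F) is a summand of Tor^S(Res X, F), through c (x) f |-> sum_i c x_i (x) f(y_i)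
    and back through c (x) v |-> c (x) unit v; the composite is [coind_expand]. *)
Lemma coind_n0_flat n (F : lmodType S) :
  n0_flat n F -> n0_flat n (coind F : lmodType A).
Proof.
move=> flatF X fpX C resC.
have acy := flatF _ (res_fin_presented rfr fpX) _ (res_proj_resolution rfr resC).
have bB i := balanced_tens_res
    (idfun : {linear rres (aug_term C i) -> rres (aug_term C i)})
    (@coind_unit _ _ _ fr F).
apply: (@tensor_acyclic_retract A S X C (coind F) (rres X)
  (@res_augmented S^c A^c (op_morphism phi) X C) F
  (fun i => casimir_tens frE x_ y_
     (fun a (c : aug_term C i) => (ract c a : rres _)) (fun a (f : coind F) => f a))
  (fun i c v => tens (@ract A _) (@lact A _) (c : aug_term C i)
     (coind_unit fr v : coind F))
  _ _ _ _ _ 0 acy) => i.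
- apply: casimir_tens_balanced; [exact: casimir_frobenius| |exact: equivariant_eval].
  exact: (@equivariant_scale S^c A^c).
- exact: bB.
- move=> c f; rewrite tensor_diff_casimir_tens; apply: eq_bigr => j _.
  by rewrite /= /res_map /ract linearZ.
- by move=> c v; rewrite tensor_diff_tens.
- move=> c f; rewrite (sub_morph_sum _ _ (tens_liftB (bB i))).
  under eq_bigr do rewrite (tens_lift_tens (bB i)).
  rewrite [f in RHS](coind_expand fr) tens_sumr.
  by apply: eq_bigr => j _; rewrite tensM.
Qed.

(** Tor^S(X, Res F) is a summand of Tor^A(Coind X, F), through c (x) m |-> unit c (x) m and back
    through f (x) m |-> sum_i f(x_i) (x) y_i m. *)
Lemma res_n0_flat n (F : lmodType A) :
  n0_flat n F -> n0_flat n (res F : lmodType S).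
Proof.
move=> flatF X fpX C resC.
have acy := flatF _ (coind_fin_presented rfr fpX) _ (coind_proj_resolution rfr resC).
have bB i : balanced (@ract A (rcoind (aug_term C i))) (@lact A F)
    (casimir_tens frE x_ y_ (fun a (f : rcoind (aug_term C i)) => f a)
      (fun a (m : F) => (a *: m : res F))).
  apply: casimir_tens_balanced; first exact: casimir_frobenius.
  - exact: (@equivariant_eval S^c A^c).
  - exact: equivariant_scale.
apply: (@tensor_acyclic_retract S A X C (res F) (rcoind X)
  (@coind_augmented S^c A^c (op_morphism phi) X C) F
  (fun i c m => tens (@ract A _) (@lact A _)
     (coind_unit rfr c : rcoind (aug_term C i)) (m : F)) _ _ bB _ _ _ 0 acy) => i.
- exact: (balanced_tens_res (@coind_unit _ _ _ rfr _) (idfun : {linear res F -> res F})).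
- by move=> c m; rewrite tensor_diff_tens /= coind_map_unit.
- by move=> c m; rewrite tensor_diff_casimir_tens.
move=> c m; rewrite (tens_lift_tens (bB i)).
(* The composite is c (x) sum_i phi(pi(x_i)) y_i m, and the sum of the phi(pi(x_i)) y_i is the dual
   basis expansion of 1. *)
rewrite -[m in RHS](scale1r (m : F)) -[1](fr_yxE fr) scaler_suml tens_sumr.
apply: eq_bigr => j _.
by rewrite coind_unitE -[_ *: _]/(ract _ _) tensM /lact res_scaleE scalerA mul1r.
Qed.

Lemma coind_Tor_zero k (X : lmodType S^c) (N : lmodType S) :
  Tor_zero k.+1 (rcoind X : lmodType A^c) (coind N) -> Tor_zero k.+1 X N.
Proof.
move=> tor C resC; have acy := tor _ (coind_proj_resolution rfr resC).
have bB i : balanced (@ract A (rcoind (aug_term C i))) (@lact A (coind N))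
    (casimir_tens frE x_ y_ (fun a (f : rcoind (aug_term C i)) => f a)
      (fun a (f : coind N) => f a)).
  apply: casimir_tens_balanced; first exact: casimir_frobenius.
  - exact: (@equivariant_eval S^c A^c).
  - exact: equivariant_eval.
apply: (@tensor_acyclic_retract S A X C N (rcoind X)
  (@coind_augmented S^c A^c (op_morphism phi) X C) (coind N)
  (fun i c v => tens (@ract A _) (@lact A _)
     (coind_unit rfr c : rcoind (aug_term C i)) (coind_unit fr v : coind N))
  _ _ bB _ _ _ k acy) => i.
- exact: (balanced_tens_res (@coind_unit _ _ _ rfr _) (@coind_unit _ _ _ fr _)).
- by move=> c v; rewrite tensor_diff_tens /= coind_map_unit.
- by move=> c f; rewrite tensor_diff_casimir_tens.
move=> c v; rewrite (tens_lift_tens (bB i)).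
(* With units in both factors the composite is c (x) sum_i pi(x_i) pi(y_i) v; the coefficient is pi
   of the expansion of 1, hence 1. *)
rewrite -[v in RHS]scale1r -(fr_pi1 fr) -[1](fr_yxE fr).
rewrite (add_morph_sum _ _ (fr_piD fr)).
rewrite scaler_suml tens_sumr; apply: eq_bigr => j _.
rewrite !coind_unitE -[fr_pi rfr _ *: _]/(ract _ _) tensM /lact scalerA.
by rewrite fr_piMl mul1r.
Qed.
End FrobeniusTor.

(** * Descent of vanishing along a separable extension *)

Section SeparableDescent.
Variables (S A : pzRingType) (phi : {rmorphism S -> A}).
Hypothesis sep : separable_ext phi.
Local Notation rres := (@restriction S^c A^c (op_morphism phi)).
Local Notation res := (restriction phi).
Hypothesis res_resolution : forall (F : lmodType A) (C : augmented F),
  proj_resolution C -> proj_resolution (res_augmented phi C).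
Hypothesis rres_resolution : forall (F : lmodType A^c) (C : augmented F),
  proj_resolution C -> proj_resolution (@res_augmented S^c A^c (op_morphism phi) F C).

(** Inserting the separability element sends X (x)_A M to X (x)_S M, and the canonical projection
    back undoes it, since sum p q = 1. *)
Lemma separable_Tor_zero k (X : lmodType A^c) (M : lmodType A) :
  Tor_zero k.+1 (rres X : lmodType S^c) (res M) -> Tor_zero k.+1 X M.
Proof.
move=> tor C /rres_resolution/tor acy; case: sep => t tE t1.
have bB i : balanced (@ract S (rres (aug_term C i))) (@lact S (res M))
    (tens (@ract A (aug_term C i)) (@lact A M)).
  exact: (balanced_tens_res (idfun : {linear rres (aug_term C i) -> rres (aug_term C i)})
    (idfun : {linear res M -> res M})).
apply: (@tensor_acyclic_retract A S X C M (rres X)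
  (@res_augmented S^c A^c (op_morphism phi) X C) (res M)
  (fun i => casimir_tens t fst snd
     (fun a (c : aug_term C i) => (ract c a : rres _))
     (fun a (m : M) => (a *: m : res M)))
  (fun i => tens (@ract A (aug_term C i)) (@lact A M)) _ bB _ _ _ k acy) => i.
- apply: casimir_tens_balanced; first exact: casimir_separable.
  + exact: (@equivariant_scale S^c A^c).
  + exact: equivariant_scale.
- move=> c m; rewrite tensor_diff_casimir_tens; apply: eq_bigr => p _.
  by rewrite /= /res_map /ract linearZ.
- by move=> c m; rewrite tensor_diff_tens.
move=> c m; rewrite (sub_morph_sum _ _ (tens_liftB (bB i))).
under eq_bigr do rewrite (tens_lift_tens (bB i)).
exact: tens_casimir_sum.
Qed.

(** A Maschke argument: an S-linear factor g of the cocycle f is averaged over the separability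
    element into an A-linear one. *)
Lemma separable_Ext_zero k (F M : lmodType A) :
  Ext_zero k.+1 (res F : lmodType S) (res M) -> Ext_zero k.+1 F M.
Proof.
move=> ext C /res_resolution/ext acy f f0; case: sep => t tE t1.
have [//|g gE] := acy (res_map phi f).
(* The same function, typed between the A-modules so that scalars from A can be used around it. *)
pose g' : aug_term C k -> M := g.
have g'D x y : g' (x + y) = g' x + g' y by exact: (raddfD g x y).
have g'Z s x : g' (phi s *: x) = phi s *: g' x by exact: (linearZ_LR g s x).
pose h (x : aug_term C k) : M := \sum_(p <- t) p.1 *: g' (p.2 *: x).
have h_lin : linear h.
  move=> a x y; rewrite /h scaler_sumr.
  under eq_bigr do rewrite scalerDr g'D scalerDr scalerA.
  rewrite big_split; congr (_ + _) => /=.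
  rewrite (casimir_separable tE (b := fun u v => u *: g' (v *: x))).
    by apply: eq_bigr => p _; rewrite scalerA.
  split=> [u u' v|u v v'|u s v]; first exact: scalerDl.
    by rewrite scalerDl g'D scalerDr.
  by rewrite -scalerA -g'Z scalerA.
pose h' := GRing.isLinear.Build A _ _ _ h h_lin.
pose hL : {linear aug_term C k -> M} := HB.pack h h'.
exists hL => x; rewrite /= /h.
(* Although g' is only S-linear, it commutes with p on boundaries, where it agrees with the A-linear
   f. *)
have g'E p : g' (p *: aug_diff C k x) = p *: f x.
  by rewrite -!linearZ; exact: esym (gE _).
under eq_bigr do rewrite g'E scalerA.
by rewrite -scaler_suml t1 scale1r.
Qed.
End SeparableDescent.

(** * Comparison of the global dimensions *)

Lemma enat_le_anti x y : enat_le x y -> enat_le y x -> x = y.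
Proof.
by case: x y => [a|] [b|] //= ab ba; congr Fin; apply/eqP; rewrite eqn_leq ab.
Qed.

(** An implication at the same degree k suffices: a finite bound on the right provides a degree
    below it where [Q j] holds, and [P i] holds there too. *)
Lemma esup_least_le (I J : Type) (P : I -> nat -> Prop) (Q : J -> nat -> Prop) :
  (forall i, exists j, forall k, Q j k -> P i k) ->
  enat_le (esup (fun i => least (P i))) (esup (fun j => least (Q j))).
Proof.
move=> QP; apply/esup_leP => i; have [j QPij] := QP i.
have /esup_leP/(_ j): enat_le (esup (fun j => least (Q j))) (esup (fun j => least (Q j))).
  by case: esup => //= k; exact: leqnn.
case: esup => [k|_]; last by case: (least _).
by move=> /enat_le_leastP[l lk /QPij Pil]; apply/enat_le_leastP; exists l.
Qed.

Section Dimensions.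
Variables (n : nat) (S A : pzRingType) (phi : {rmorphism S -> A}).
Variable fr : split_frobenius phi.

Lemma frobenius_n0_ID_le : enat_le (n0_ID n S) (n0_ID n A).
Proof.
apply: esup_least_le => N; exists (coind phi N) => k ext F fpF.
exact/(coind_Ext_zero fr)/ext/(coind_fin_presented fr).
Qed.

Lemma frobenius_n0_FD_le : enat_le (n0_FD n S) (n0_FD n A).
Proof.
apply: esup_least_le => N; exists (coind phi N) => k tor X fpX.
exact/(coind_Tor_zero fr)/tor/(coind_fin_presented (op_frobenius fr)).
Qed.

Lemma frobenius_nC_gldim_le : enat_le (nC_gldim n S) (nC_gldim n A).
Proof.
apply: esup_least_le => N; exists (coind phi N) => k ext F flatF.
exact/(coind_Ext_zero fr)/ext/(coind_n0_flat fr).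
Qed.

Hypothesis sep : separable_ext phi.

Lemma separable_n0_ID_le : enat_le (n0_ID n A) (n0_ID n S).
Proof.
apply: esup_least_le => M; exists (restriction phi M) => k ext F fpF.
apply: (separable_Ext_zero sep); first by move=> *; exact: res_proj_resolution.
exact/ext/(res_fin_presented fr).
Qed.

Lemma separable_n0_FD_le : enat_le (n0_FD n A) (n0_FD n S).
Proof.
apply: esup_least_le => M; exists (restriction phi M) => k tor X fpX.
apply: (separable_Tor_zero sep).
  by move=> *; exact: (res_proj_resolution (op_frobenius fr)).
exact/tor/(res_fin_presented (op_frobenius fr)).
Qed.

Lemma separable_nC_gldim_le : enat_le (nC_gldim n A) (nC_gldim n S).
Proof.
apply: esup_least_le => M; exists (restriction phi M) => k ext F flatF.
apply: (separable_Ext_zero sep); first by move=> *; exact: res_proj_resolution.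
exact/ext/(res_n0_flat fr).
Qed.
End Dimensions.

(** * Skew group rings *)

Section SkewFrobenius.
Variables (G : finGroupType) (R : pzRingType) (to : ring_action G R).
Variable H : {group G}.
Local Notation RG := (skew_group_ring to).
Local Notation RH := (skew_group_ring (restr_action to H)).

Definition skew_proj (u : RG) : RH := [ffun h : [subg H] => u (sgval h)].

Lemma skew_projD : {morph skew_proj : u v / u + v}.
Proof. by move=> u v; apply/ffunP=> h; rewrite !ffunE. Qed.

Lemma skew_proj1 : skew_proj 1 = 1.
Proof. by apply/ffunP=> h; rewrite !ffunE -(inj_eq val_inj). Qed.

Lemma skew_projMl s u : skew_proj (skew_incl s * u) = s * skew_proj u.
Proof.
apply/ffunP=> k; rewrite !ffunE (bigID (mem H)) /=.
rewrite [X in _ + X]big1 => [|g /negbTE ngH]; last by rewrite !ffunE ngH mul0r.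
rewrite addr0 (reindex (@sgval _ H)); last first.
  by exists (subg H) => [h _|g gH]; [exact: sgvalK|exact: subgK].
by apply: eq_big => [h|h _]; rewrite ?subgP // !ffunE subgP sgvalK.
Qed.

Lemma skew_projMr u s : skew_proj (u * skew_incl s) = skew_proj u * s.
Proof.
apply/ffunP=> k; rewrite !ffunE (bigID (mem H)) /=.
rewrite [X in _ + X]big1 => [|g /negbTE ngH]; last first.
  (* For k in H and g outside H, the element g^-1 k is outside H, where the included [s]
     vanishes. *)
  by rewrite !ffunE groupMr ?subgP // groupV ngH rmorph0 mulr0.
rewrite addr0 (reindex (@sgval _ H)); last first.
  by exists (subg H) => [h _|g gH]; [exact: sgvalK|exact: subgK].
apply: eq_big => [h|h _]; first exact: subgP.
rewrite !ffunE groupM ?groupV ?subgP //; congr (_ * to _ (s _)).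
by apply: val_inj; rewrite /= subgK // groupM ?groupV ?subgP.
Qed.

Lemma skew_incl_proj_monom a g :
  skew_incl (skew_proj (skew_monom to a g)) =
  if g \in H then skew_monom to a g else 0.
Proof.
apply/ffunP=> k; rewrite !ffunE; case: ifP => [kH|/negbT kH].
  rewrite subgK //; case: eqP => [<-|nkg]; first by rewrite kH ffunE eqxx.
  by case: ifP; rewrite ffunE //; case: eqP.
case: ifP => gH; rewrite ffunE //.
by case: eqP => // kg; rewrite kg gH in kH.
Qed.

(* Indexing the dual bases by G rather than by a transversal, [delta] kills all
   but one representative of each right coset of H. *)
Let delta (g : G) : R := (g == repr (H :* g)%g)%:R.
Let x_ (g : G) : RG := skew_monom to (delta g) g^-1%g.
Let y_ (g : G) : RG := skew_monom to (delta g) g.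

Lemma skew_monom0 g : skew_monom to 0 g = 0.
Proof. by apply/ffunP=> k; rewrite !ffunE; case: eqP. Qed.

Let coset_sum (g : G) (F : G -> RG) :
  (forall r, r \in (H :* g)%g -> r != repr (H :* g)%g -> F r = 0) ->
  \sum_(r in (H :* g)%g) F r = F (repr (H :* g)%g).
Proof.
move=> F0; rewrite (bigD1 (repr (H :* g)%g)) ?mem_repr_rcoset //=.
by rewrite big1 ?addr0 // => r /andP[? ?]; exact: F0.
Qed.

(** By additivity take a = b g. The projection keeps the index r exactly when g r^-1 is in H, that
    is r in H g, and [delta] leaves only the representative of that coset, giving b g r^-1 r. *)
Let skew_yxE (a : RG) : \sum_g skew_incl (skew_proj (a * x_ g)) * y_ g = a.
Proof.
rewrite [in RHS](skew_sumE a) [in LHS](skew_sumE a).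
under eq_bigr => r _.
  rewrite mulr_suml (add_morph_sum _ _ skew_projD).
  rewrite rmorph_sum mulr_suml.
  over.
rewrite exchange_big; apply: eq_bigr => g _ /=.
rewrite (bigID (mem (H :* g)%g)) /= [X in _ + X]big1 => [|r nr]; last first.
  rewrite skew_monomM skew_incl_proj_monom ifN ?mul0r //.
  by rewrite -groupV invMg invgK -mem_rcoset.
rewrite addr0 coset_sum => [|r rg nr]; last first.
  have -> : y_ r = 0; last by rewrite mulr0.
  by rewrite /y_ /delta (rcoset_eqP rg) (negbTE nr) skew_monom0.
have rg := mem_repr_rcoset H g.
rewrite skew_monomM skew_incl_proj_monom.
rewrite -groupV invMg invgK -mem_rcoset rg skew_monomM.
by rewrite /delta (rcoset_eqP rg) eqxx !rmorph1 !mulr1 mulgKV.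
Qed.

(** Mirror image of [skew_yxE]: r g is in H exactly when r lies in H g^-1. The coefficient is acted
    on by r and then by r^-1, which cancel. *)
Let skew_xyE (a : RG) : \sum_g x_ g * skew_incl (skew_proj (y_ g * a)) = a.
Proof.
rewrite [in RHS](skew_sumE a) [in LHS](skew_sumE a).
under eq_bigr => r _.
  rewrite mulr_sumr (add_morph_sum _ _ skew_projD).
  rewrite rmorph_sum mulr_sumr.
  over.
rewrite exchange_big; apply: eq_bigr => g _ /=.
rewrite (bigID (mem (H :* g^-1)%g)) /= [X in _ + X]big1 => [|r nr]; last first.
  rewrite skew_monomM skew_incl_proj_monom ifN ?mulr0 //.
  by rewrite mem_rcoset invgK in nr.
rewrite addr0 coset_sum => [|r rg nr]; last first.
  have -> : x_ r = 0; last by rewrite mul0r.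
  by rewrite /x_ /delta (rcoset_eqP rg) (negbTE nr) skew_monom0.
have rg := mem_repr_rcoset H g^-1%g.
rewrite skew_monomM skew_incl_proj_monom.
move: (rg); rewrite mem_rcoset invgK => ->; rewrite skew_monomM.
rewrite /delta (rcoset_eqP rg) eqxx !mul1r -ra_M mulVg ra_1.
by rewrite mulKg.
Qed.

Definition skew_frobenius : split_frobenius (@skew_incl G R to H) :=
  SplitFrobenius skew_projD skew_projMl skew_projMr skew_proj1
    skew_xyE skew_yxE.
End SkewFrobenius.

Theorem corollary5p1 (R : pzRingType) (G : finGroupType)
    (to : ring_action G R) (H : {group G}) (n : nat) :
  let RG : pzRingType := skew_group_ring to in
  let RH : pzRingType := skew_group_ring (restr_action to H) in
  let RG_separable_over_RH : Prop := separable_ext (@skew_incl G R to H) in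
  (enat_le (n0_ID n RH) (n0_ID n RG) /\
     (RG_separable_over_RH -> n0_ID n RH = n0_ID n RG)) /\
  (enat_le (n0_FD n RH) (n0_FD n RG) /\
     (RG_separable_over_RH -> n0_FD n RH = n0_FD n RG)) /\
  (enat_le (nC_gldim n RH) (nC_gldim n RG) /\
     (RG_separable_over_RH -> nC_gldim n RH = nC_gldim n RG)).
Proof.
pose fr := skew_frobenius to H; split; [|split]; split=> [|sep].
- exact: frobenius_n0_ID_le fr.
- by apply: enat_le_anti (frobenius_n0_ID_le n fr) (separable_n0_ID_le n fr sep).
- exact: frobenius_n0_FD_le fr.
- by apply: enat_le_anti (frobenius_n0_FD_le n fr) (separable_n0_FD_le n fr sep).
- exact: frobenius_nC_gldim_le fr.
- by apply: enat_le_anti (frobenius_nC_gldim_le n fr) (separable_nC_gldim_le n fr sep).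
Qed.
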